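(* Let $u\in\mathbb{R}^n$ have all entries positive, $\alpha_u>0$, $B_i\in\mathbb{R}^{n\times n}$ with $j$-th row $B_{ij}$, $c_i\in\mathbb{R}^n$, $d_i\in\mathbb{R}$. Let $x\in\mathbb{R}^n$ with $x\ge0$ and $\alpha_u\ge u^Tx$, and let $X$ be a symmetric $n\times n$ matrix. The KSOC inequality $\widetilde T_i\preceq0$, where $$\widetilde T_i=\begin{pmatrix}-\Phi&&&V_1^i\\ &\ddots&&\vdots\\ &&-\Phi&V_n^i\\ (V_1^i)^T&\cdots&(V_n^i)^T&W^i\end{pmatrix}$$ (with $n$ diagonal blocks $-\Phi$ and zero off-diagonal blocks among them; $\Phi,V_j^i,W^i$ as in the context), is dominated by the SOC-RLT constraints generated by $x\ge0$, $\alpha_u\ge u^Tx$ and $\|B_ix\|^2\le-c_i^Tx-d_i$; that is, $\widetilde T_i\preceq0$ holds whenever $(x,X)$ satisfies, for $j=1,\dots,n$, $$\left\|\begin{pmatrix}B_iX_{\cdot,j}\\ \tfrac12(x_j+c_i^TX_{\cdot,j}+d_ix_j)\end{pmatrix}\right\|\le\tfrac12(x_j-c_i^TX_{\cdot,j}-d_ix_j)$$ and $$\left\|\begin{pmatrix}\alpha_uB_ix-B_iXu\\ \tfrac12\left(\alpha_u(1+c_i^Tx+d_i)-(1+d_i)u^Tx-u^TXc_i\right)\end{pmatrix}\right\|\le\tfrac12\left(\alpha_u(1-c_i^Tx-d_i)-(1-d_i)u^Tx+u^TXc_i\right).$$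
   Context: $\mathrm{diag}(v)$ is the diagonal matrix with diagonal $v$; $X_{\cdot,j}$ is the $j$-th column of $X$; $\|\cdot\|$ is the Euclidean norm; $A\preceq0$ means $-A$ is positive semidefinite. Define the $(n+1)\times(n+1)$ matrices $$\Phi=\begin{pmatrix}\mathrm{diag}(u)\mathrm{diag}(x)&\mathrm{diag}(u)x\\ x^T\mathrm{diag}(u)&\alpha_u\end{pmatrix},\qquad V_j^i=\begin{pmatrix}\mathrm{diag}(u)\mathrm{diag}(XB_{ij}^T)&\mathrm{diag}(u)XB_{ij}^T\\ B_{ij}X\mathrm{diag}(u)&\alpha_uB_{ij}x\end{pmatrix},$$ $$W^i=\begin{pmatrix}\mathrm{diag}(u)\mathrm{diag}(Xc_i+d_ix)&\mathrm{diag}(u)(Xc_i+d_ix)\\ (Xc_i+d_ix)^T\mathrm{diag}(u)&\alpha_u(c_i^Tx+d_i)\end{pmatrix}.$$ $\widetilde T_i$ is the linearization (replacing $xx^T$ by $X$) of the Kronecker product $\begin{pmatrix}-I&B_ix\\ x^TB_i^T&c_i^Tx+d_i\end{pmatrix}\otimes\Phi$. The underlying convex quadratic constraint is $x^TQ_ix+c_i^Tx+d_i\le0$ with $Q_i=B_i^TB_i$. A constraint is dominated by a set of constraints if it is implied by them. *)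

(* Defs.v *)
From mathcomp Require Import all_boot all_order all_algebra.

Set Implicit Arguments.
Unset Strict Implicit.
Unset Printing Implicit Defensive.

Import Order.TTheory GRing.Theory Num.Theory.
Local Open Scope ring_scope.

(* All vectors are columns; the rows B_ij are [row j B]. *)

Definition dotv (R : pzRingType) (n : nat) (u v : 'cV[R]_n) : R :=
  (u^T *m v) 0 0.

Definition enorm (R : rcfType) (n : nat) (v : 'cV[R]_n) : R :=
  Num.sqrt (\sum_(k < n) v k 0 ^+ 2).

(* [diag_mx] expects a row vector. *)
Definition diagc (R : pzRingType) (n : nat) (v : 'cV[R]_n) : 'M[R]_n :=
  diag_mx v^T.

Definition psdmx (R : rcfType) (n : nat) (A : 'M[R]_n) : Prop :=
  A^T = A /\ forall v : 'cV[R]_n, 0 <= (v^T *m A *m v) 0 0.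

Definition nsdmx (R : rcfType) (n : nat) (A : 'M[R]_n) : Prop :=
  psdmx (- A).

Definition Phi (R : rcfType) (n : nat) (u : 'cV[R]_n) (alpha : R)
    (x : 'cV[R]_n) : 'M[R]_(n + 1) :=
  block_mx (diagc u *m diagc x) (diagc u *m x)
           (x^T *m diagc u)     alpha%:M.

Definition Vmx (R : rcfType) (n : nat) (u : 'cV[R]_n) (alpha : R)
    (B : 'M[R]_n) (x : 'cV[R]_n) (X : 'M[R]_n) (j : 'I_n) :
    'M[R]_(n + 1) :=
  let Bj : 'rV[R]_n := row j B in
  block_mx (diagc u *m diagc (X *m Bj^T)) (diagc u *m (X *m Bj^T))
           (Bj *m X *m diagc u)           (alpha *: (Bj *m x)).

Definition Wmx (R : rcfType) (n : nat) (u : 'cV[R]_n) (alpha : R)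
    (c : 'cV[R]_n) (d : R) (x : 'cV[R]_n) (X : 'M[R]_n) :
    'M[R]_(n + 1) :=
  let w : 'cV[R]_n := X *m c + d *: x in
  block_mx (diagc u *m diagc w) (diagc u *m w)
           (w^T *m diagc u)     (alpha * (dotv c x + d))%:M.

(* The blocks are those of the Kronecker product: with X = x x^T, [Vmx] is
   (B_ij x) Phi and [Wmx] is (c^T x + d) Phi, see [VmxE] and [WmxE]. *)
Definition KSOCmx (R : rcfType) (n : nat) (u : 'cV[R]_n) (alpha : R)
    (B : 'M[R]_n) (c : 'cV[R]_n) (d : R) (x : 'cV[R]_n) (X : 'M[R]_n) :
    'M[R]_(\sum_(j < n) (n + 1) + (n + 1)) :=
  block_mx (\mxdiag_(j < n) - Phi u alpha x)
           (\mxcol_(j < n) Vmx u alpha B x X j)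
           (\mxrow_(j < n) (Vmx u alpha B x X j)^T)
           (Wmx u alpha c d x X).

Lemma diagcZ (R : comNzRingType) (n : nat) (a : R) (v : 'cV[R]_n) :
  diagc (a *: v) = a *: diagc v.
Proof. by rewrite /diagc !linearZ. Qed.

Lemma mulmx11r (R : comNzRingType) (n : nat) (v : 'cV[R]_n) (s : 'M[R]_1) :
  v *m s = s 0 0 *: v.
Proof. by rewrite {1}[s]mx11_scalar mul_mx_scalar. Qed.

Lemma VmxE (R : rcfType) (n : nat) (u : 'cV[R]_n) (alpha : R)
    (B : 'M[R]_n) (x : 'cV[R]_n) (j : 'I_n) :
  Vmx u alpha B x (x *m x^T) j = (row j B *m x) 0 0 *: Phi u alpha x.
Proof.
rewrite /Vmx /Phi; set b := row j B.
have e1 : x *m x^T *m b^T = (b *m x) 0 0 *: x.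
  by rewrite -mulmxA -trmx_mul mulmx11r [X in X *: _]mxE.
have e2 : b *m (x *m x^T) = (b *m x) 0 0 *: x^T.
  by rewrite mulmxA [X in X *m _]mx11_scalar mul_scalar_mx.
have e3 : alpha *: (b *m x) = (b *m x) 0 0 *: alpha%:M.
  by rewrite [X in _ *: X = _]mx11_scalar !scale_scalar_mx mulrC.
by rewrite e1 e2 e3 diagcZ scale_block_mx -!scalemxAr -scalemxAl.
Qed.

Lemma WmxE (R : rcfType) (n : nat) (u : 'cV[R]_n) (alpha : R)
    (c : 'cV[R]_n) (d : R) (x : 'cV[R]_n) :
  Wmx u alpha c d x (x *m x^T) = (dotv c x + d) *: Phi u alpha x.
Proof.
rewrite /Wmx /Phi.
have -> : x *m x^T *m c + d *: x = (dotv c x + d) *: x.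
  rewrite scalerDl /dotv -mulmxA -[x^T *m c]trmxK trmx_mul trmxK mulmx11r.
  by rewrite [X in X *: _ + _]mxE.
rewrite diagcZ scale_block_mx -!scalemxAr linearZ /= -scalemxAl.
by rewrite scale_scalar_mx mulrC.
Qed.

(* Main.v *)
Require Import Defs.
From mathcomp Require Import all_boot all_order all_algebra.
From mathcomp Require Import ring lra.

Set Implicit Arguments.
Unset Strict Implicit.
Unset Printing Implicit Defensive.

Import Order.TTheory GRing.Theory Num.Theory.
Local Open Scope ring_scope.

(** With [f_k = e_k + e_(n+1)], where [e_1, .., e_(n+1)] is the standard basis,
    [Phi = sum_k u_k x_k f_k f_k^T + (alpha - u^T x) e_(n+1) e_(n+1)^T].
    The blocks [V_j] and [W] are the same combinations of rank-one matrices: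
    their coefficients are the linearized products of the affine functions
    [x_k] and [alpha - u^T x] with [B_j x] and with [c^T x + d]
    ([slackmx_form]).  So one congruence diagonalizes all the blocks
    simultaneously, and after regrouping the variables the form of the large
    matrix is a sum of [n + 1] independent arrow forms
      [-a |P|^2 + 2 (b . P) q + w q^2],
    one for each linear constraint [x_k >= 0] (with weight [u_k > 0]) and one
    for [u^T x <= alpha] (with weight 1); this is [KSOCmx_form].  The triple
    [(a, b, w)] of each of them is the one occurring in the SOC-RLT constraint
    that this linear inequality generates.  That constraint implies the rotated
    cone condition [|b|^2 <= - a w], which makes the arrow form nonpositive:
    this is [soc_form_le0], a Schur complement argument. *)

(** * Forms of the matrices and of their blocks *)

Lemma dotvE (R : pzRingType) (n : nat) (v w : 'cV[R]_n) :
  dotv v w = \sum_k v k 0 * w k 0.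
Proof. by rewrite /dotv mxE; apply: eq_bigr => k _; rewrite mxE. Qed.

(** The linearization of [l * Phi] for an affine function [l] of [x]: [y] stands
    for the linearized [l x] and [beta] for [alpha l].  The cases [l = 1],
    [l = B_j x] and [l = c^T x + d] are [Phi], [V_j] and [W]. *)
Definition slackmx (R : comNzRingType) (n : nat) (u y : 'cV[R]_n) (beta : R) :
    'M[R]_(n + 1) :=
  block_mx (diagc u *m diagc y) (diagc u *m y)
           (y^T *m diagc u)     beta%:M.

Lemma slackmx_sym (R : comNzRingType) (n : nat) (u y : 'cV[R]_n) (beta : R) :
  (slackmx u y beta)^T = slackmx u y beta.
Proof.
rewrite /slackmx /diagc tr_block_mx !trmx_mul !tr_diag_mx tr_scalar_mx trmxK.
by rewrite diag_mxC.
Qed.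

(** The decomposition of [slackmx] into rank-one terms: [p_k + s] is the
    pairing of [(p, s)] with [e_k + e_(n+1)].  Completing the square in this way
    leaves [beta - u^T y] on the last coordinate. *)
Lemma slackmx_form (R : comNzRingType) (n : nat) (u y : 'cV[R]_n) (beta : R)
    (p q : 'cV[R]_(n + 1)) :
  (p^T *m slackmx u y beta *m q) 0 0 =
  \sum_k u k 0 * (y k 0 * ((usubmx p k 0 + dsubmx p 0 0)
                          * (usubmx q k 0 + dsubmx q 0 0)))
  + (beta - dotv u y) * (dsubmx p 0 0 * dsubmx q 0 0).
Proof.
rewrite -[p in LHS]vsubmxK -[q in LHS]vsubmxK.
move: (usubmx p) (dsubmx p) (usubmx q) (dsubmx q) => p' s q' t.
rewrite tr_col_mx mul_row_block mul_row_col !mulmxDl -!mulmxA /diagc.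
rewrite !mul_diag_mx [s]mx11_scalar [t]mx11_scalar.
rewrite !tr_scalar_mx !mul_scalar_mx !mul_mx_scalar dotvE !mxE !eqxx !mulr1n.
suff -> : \sum_k u k 0 * (y k 0 * ((p' k 0 + s 0 0) * (q' k 0 + t 0 0))) =
    \sum_k u k 0 * (y k 0 * (p' k 0 * q' k 0))
    + s 0 0 * (\sum_k u k 0 * (y k 0 * q' k 0))
    + \sum_k u k 0 * (y k 0 * p' k 0) * t 0 0
    + (\sum_k u k 0 * y k 0) * (s 0 0 * t 0 0).
  under eq_bigr => k _ do rewrite !mxE (mulrCA (p' k 0)) (mulrCA (p' k 0)).
  under [X in _ + s 0 0 * X + _]eq_bigr => k _ do rewrite !mxE mulrCA.
  under [X in _ + (X + _)]eq_bigr => k _ do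
    rewrite !mxE mulrCA (mulrC (t 0 0)) (mulrA (p' k 0)) (mulrC (p' k 0))
            mulrA.
  ring.
rewrite mulr_sumr mulr_suml -!big_split /=.
by apply: eq_bigr => k _; ring.
Qed.

Lemma arrow_form (R : comNzRingType) (n m : nat) (D W : 'M[R]_m)
    (V : 'I_n -> 'M[R]_m) (v : 'cV[R]_(\sum_(j < n) m + m)) :
  let p j := submxcol (usubmx v) j in
  let q := dsubmx v in
  (v^T *m block_mx (\mxdiag_(j < n) D) (\mxcol_j V j)
                   (\mxrow_j (V j)^T)   W *m v) 0 0 =
  \sum_j ((p j)^T *m D *m p j) 0 0 + (\sum_j ((p j)^T *m V j *m q) 0 0) *+ 2
    + (q^T *m W *m q) 0 0.
Proof.
move=> p q.
have vE : v = col_mx (\mxcol_j p j) q by rewrite submxcolK vsubmxK.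
rewrite {1 2}vE tr_col_mx tr_mxcol mul_row_block mul_row_col.
rewrite mul_mxrow_mxdiag mul_mxrow_mxcol mul_mxrow.
rewrite !mulmxDl !mul_mxrow_mxcol.
have cE : \sum_i (q^T *m (V i)^T *m p i) = (\sum_i ((p i)^T *m V i *m q))^T.
  rewrite raddf_sum /=; apply: eq_bigr => i _.
  by rewrite !trmx_mul trmxK mulmxA.
rewrite cE mulmx_suml !mxE !summxE mulr2n; ring.
Qed.

Lemma arrow_sym (R : comNzRingType) (n m : nat) (D W : 'M[R]_m)
    (V : 'I_n -> 'M[R]_m) : D^T = D -> W^T = W ->
  (block_mx (\mxdiag_(j < n) D) (\mxcol_j V j) (\mxrow_j (V j)^T) W)^T =
  block_mx (\mxdiag_(j < n) D) (\mxcol_j V j) (\mxrow_j (V j)^T) W.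
Proof.
move=> Dsym Wsym; rewrite tr_block_mx tr_mxdiag tr_mxcol tr_mxrow Wsym Dsym.
by under eq_mxcol => j do rewrite trmxK.
Qed.

(** * Arrow forms and second-order cones *)

(** The norm inequality squares to [|b|^2 <= - a w].  For [a > 0], completing
    the square gives
    [a * form = - |a P - q b|^2 + (|b|^2 + a w) q^2 <= 0]; for [a = 0] it forces
    [b = 0], and the sign of the right-hand side forces [w <= 0]. *)
Lemma soc_form_le0 (R : rcfType) (n : nat) (b : 'cV[R]_n) (a w : R) :
  0 <= a ->
  enorm (col_mx b (2^-1 * (a + w))%:M) <= 2^-1 * (a - w) ->
  forall (P : 'I_n -> R) (q : R),
  - a * (\sum_j P j ^+ 2) + (\sum_j b j 0 * P j) * q *+ 2 + w * q ^+ 2 <= 0.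
Proof.
move=> a_ge0 soc P q.
have nb_ge0 m (z : 'cV[R]_m) : 0 <= \sum_k z k 0 ^+ 2.
  by apply: sumr_ge0 => k _; apply: sqr_ge0.
have aw_ge0 : 0 <= 2^-1 * (a - w) by apply: le_trans soc; apply: sqrtr_ge0.
have b_le : \sum_k b k 0 ^+ 2 <= - (a * w).
  move: soc; rewrite /enorm -(ler_sqr (sqrtr_ge0 _) aw_ge0) sqr_sqrtr //.
  rewrite big_split_ord /= big_ord1 col_mxEd.
  under eq_bigr => k _ do rewrite col_mxEu.
  rewrite mxE eqxx mulr1n; move: (\sum_k _) => N; lra.
have [a0|a_neq0] := eqVneq a 0.
  have b0 k : b k 0 = 0.
    apply/eqP; rewrite -(@sqrf_eq0 R).
    have : \sum_k b k 0 ^+ 2 == 0.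
      by rewrite eq_le nb_ge0 andbT (le_trans b_le) // a0 mul0r oppr0.
    rewrite psumr_eq0 => [/allP/(_ k)|i _]; last exact: sqr_ge0.
    by apply; rewrite mem_index_enum.
  rewrite a0 oppr0 mul0r add0r big1 => [|k _]; last by rewrite b0 mul0r.
  rewrite mul0r mul0rn add0r mulr_le0_ge0 ?sqr_ge0 //.
  by move: aw_ge0; rewrite a0; lra.
have a_gt0 : 0 < a by rewrite lt_def a_neq0.
rewrite -(pmulr_rle0 _ a_gt0).
have : 0 <= \sum_j (a * P j - b j 0 * q) ^+ 2.
  by apply: sumr_ge0 => k _; apply: sqr_ge0.
have -> : \sum_j (a * P j - b j 0 * q) ^+ 2 =
    a ^+ 2 * (\sum_j P j ^+ 2) - a * (\sum_j b j 0 * P j) * q *+ 2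
    + (\sum_j b j 0 ^+ 2) * q ^+ 2.
  rewrite !mulr_sumr !mulr_suml -sumrMnl -sumrB -big_split /=.
  by apply: eq_bigr => j _; ring.
have := ler_wpM2r (sqr_ge0 q) b_le.
move: (\sum_j b j 0 ^+ 2) (\sum_j P j ^+ 2) (\sum_j _) => N S C; nra.
Qed.

(** * The form of the linearized Kronecker product *)

(** Each [slackmx] form is a sum indexed by the linear constraints, so
    exchanging the sums over blocks and constraints separates the total form
    into one arrow form per constraint.  Symmetry of [X] is what makes the
    coefficients [X B_j^T] and [X c] agree with the columns [B X_k] and
    [c^T X_k] of the SOC-RLT constraints. *)
Lemma KSOCmx_form (R : rcfType) (n : nat) (u : 'cV[R]_n) (alpha : R)
    (B : 'M[R]_n) (c : 'cV[R]_n) (d : R) (x : 'cV[R]_n) (X : 'M[R]_n)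
    (v : 'cV[R]_(\sum_(j < n) (n + 1) + (n + 1))) :
  X^T = X ->
  let p j : 'cV[R]_(n + 1) := submxcol (usubmx v) j in
  let q := dsubmx v in
  let P j k := usubmx (p j) k 0 + dsubmx (p j) 0 0 in
  let S j := dsubmx (p j) 0 0 in
  let Q k := usubmx q k 0 + dsubmx q 0 0 in
  let t := dsubmx q 0 0 in
  let beta := alpha - dotv u x in
  let b := alpha *: (B *m x) - B *m X *m u in
  let g := alpha * (dotv c x + d) - dotv u (X *m c) - d * dotv u x in
  (v^T *m KSOCmx u alpha B c d x X *m v) 0 0 =
  \sum_k u k 0 * (- x k 0 * (\sum_j P j k ^+ 2)
                  + (\sum_j (B *m col k X) j 0 * P j k) * Q k *+ 2
                  + (dotv c (col k X) + d * x k 0) * Q k ^+ 2)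
  + (- beta * (\sum_j S j ^+ 2) + (\sum_j b j 0 * S j) * t *+ 2
     + g * t ^+ 2).
Proof.
move=> hX p q P S Q t beta b g.
have PhiE : Phi u alpha x = slackmx u x alpha by [].
pose y j : 'cV[R]_n := X *m (row j B)^T.
have VE j : Vmx u alpha B x X j = slackmx u (y j) (alpha * (B *m x) j 0).
  rewrite /Vmx /slackmx /y trmx_mul trmxK hX; congr block_mx.
  by rewrite [LHS]mx11_scalar -row_mul !mxE.
pose w : 'cV[R]_n := X *m c + d *: x.
have WE : Wmx u alpha c d x X = slackmx u w (alpha * (dotv c x + d)) by [].
have symX j k : X j k = X k j by rewrite -{1}hX mxE.
have yE j k : y j k 0 = (B *m col k X) j 0.
  by rewrite !mxE; apply: eq_bigr => l _; rewrite !mxE mulrC symX.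
have wE k : w k 0 = dotv c (col k X) + d * x k 0.
  rewrite !mxE dotvE; congr (_ + _).
  by apply: eq_bigr => l _; rewrite !mxE mulrC symX.
have uyE j : dotv u (y j) = (B *m X *m u) j 0.
  have -> : (B *m X *m u) j 0 = (row j B *m X *m u)^T 0 0.
    by rewrite -!row_mul !mxE.
  by rewrite /dotv /y !trmx_mul hX.
have uwE : dotv u w = dotv u (X *m c) + d * dotv u x.
  by rewrite /dotv mulmxDr -scalemxAr !mxE.
have PhiS : \sum_j ((p j)^T *m - Phi u alpha x *m p j) 0 0 =
    \sum_k u k 0 * (- x k 0 * (\sum_j P j k ^+ 2)) - beta * (\sum_j S j ^+ 2).
  under eq_bigr => j _ do
    rewrite mulmxN mulNmx mxE PhiE slackmx_form -/beta opprD.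
  rewrite big_split /= mulr_sumr !sumrN; congr (_ - _).
  rewrite exchange_big -sumrN; apply: eq_bigr => k _ /=.
  by rewrite mulNr mulrN !mulr_sumr.
have VS : \sum_j ((p j)^T *m Vmx u alpha B x X j *m q) 0 0 =
    \sum_k u k 0 * ((\sum_j (B *m col k X) j 0 * P j k) * Q k)
    + (\sum_j b j 0 * S j) * t.
  under eq_bigr => j _ do rewrite VE slackmx_form uyE.
  rewrite big_split exchange_big /=; congr (_ + _).
    apply: eq_bigr => k _; rewrite mulr_suml mulr_sumr.
    by apply: eq_bigr => j _; rewrite yE !mulrA.
  rewrite mulr_suml; apply: eq_bigr => j _; rewrite mulrA; congr (_ * _ * _).
  by rewrite /b !mxE.
have WS : (q^T *m Wmx u alpha c d x X *m q) 0 0 =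
    \sum_k u k 0 * ((dotv c (col k X) + d * x k 0) * Q k ^+ 2) + g * t ^+ 2.
  rewrite WE slackmx_form uwE opprD addrA -/g; congr (_ + _).
  by apply: eq_bigr => k _; rewrite wE.
under [in RHS]eq_bigr => k _ do rewrite 2!mulrDr mulrnAr.
rewrite arrow_form PhiS VS WS 2!big_split /= sumrMnl; ring.
Qed.

Theorem theorem5p1 (R : rcfType) (n : nat)
    (u : 'cV[R]_n) (alpha : R) (B : 'M[R]_n) (c : 'cV[R]_n) (d : R)
    (x : 'cV[R]_n) (X : 'M[R]_n)
    (hu : forall k, 0 < u k 0) (halpha : 0 < alpha)
    (hx : forall k, 0 <= x k 0) (hux : dotv u x <= alpha)
    (hX : X^T = X)
    (hsoc_x : forall j : 'I_n,
       let Xj : 'cV[R]_n := col j X in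
       enorm (col_mx (B *m Xj)
                (2^-1 * (x j 0 + dotv c Xj + d * x j 0))%:M)
       <= 2^-1 * (x j 0 - dotv c Xj - d * x j 0))
    (hsoc_u :
       enorm (col_mx (alpha *: (B *m x) - B *m X *m u)
                (2^-1 * (alpha * (1 + dotv c x + d)
                         - (1 + d) * dotv u x - dotv u (X *m c)))%:M)
       <= 2^-1 * (alpha * (1 - dotv c x - d)
                  - (1 - d) * dotv u x + dotv u (X *m c))) :
  nsdmx (KSOCmx u alpha B c d x X).
Proof.
split=> [|v].
  by rewrite linearN /= arrow_sym // ?linearN /= slackmx_sym.
rewrite mulmxN mulNmx mxE oppr_ge0 KSOCmx_form //.
rewrite -[leRHS]addr0 lerD //.
  apply: sumr_le0 => k _; rewrite pmulr_rle0 //; apply: soc_form_le0 => //.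
  by rewrite addrA opprD addrA; apply: hsoc_x.
apply: soc_form_le0; first by rewrite subr_ge0.
(* The scalars in [hsoc_u] are [(a + w) / 2] and [(a - w) / 2] expanded, where
   [a = alpha - u^T x] and [w = alpha (c^T x + d) - u^T X c - d u^T x]. *)
apply: le_trans (le_trans hsoc_u _); rewrite le_eqVlt; apply/orP; left.
  by apply/eqP; congr (enorm (col_mx _ (_ * _)%:M)); ring.
by apply/eqP; congr (_ * _); ring.
Qed.
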